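(* Let $X$ be a Hausdorff topological space and let $\mathscr{F}=\{f_1,\dots,f_k\}$ be a finite set of homeomorphisms of $X$ such that $f^{-1}\in\mathscr{F}$ for every $f\in\mathscr{F}$ (a symmetric IFS). Then every quasi-attractor of the IFS generated by $\mathscr{F}$ is renderable by the deterministic chaos game.
   Context: $\Gamma$ is the semigroup generated by $\mathscr{F}$ (all compositions of one or more generators), $\Gamma(x)=\{g(x):g\in\Gamma\}$, and $F(K)=\bigcup_{i=1}^k f_i(K)$ for non-empty compact $K\subset X$. A quasi-attractor is a non-empty compact set $A\subset X$ with $F(A)=A$ and $A=\overline{\Gamma(x)}$ for all $x\in A$. $\mathcal{B}^*_p(A)=\{x\in X:\bigcap_{m\in\mathbb{N}}\overline{\bigcup_{n\ge m}F^n(\{x\})}=A\}$. $\Omega=\{1,\dots,k\}^{\mathbb{N}}$; for $\omega\in\Omega$, $f^n_\omega=f_{\omega_n}\circ\cdots\circ f_{\omega_1}$ and $O^+_\omega(x)=\{f^n_\omega(x):n\in\mathbb{N}\}$. $\mathbb{P}$ is any fixed Borel probability on $\Omega$ for which there is $0<p\le1/k$ with $\mathbb{P}(\omega_n=i\mid\omega_{n-1},\dots,\omega_1)\ge p$ for all $i\in\{1,\dots,k\}$, $n\in\mathbb{N}$. A quasi-attractor $A$ is renderable by the deterministic chaos game if there is $\Omega_0\subset\Omega$ with $\mathbb{P}(\Omega_0)=1$ such that $A\subset\overline{O^+_\omega(x)}$ for all $\omega\in\Omega_0$ and $x\in\mathcal{B}^*_p(A)$. *)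

(* Defs.v *)
From HB Require Import structures.
From mathcomp Require Import all_boot all_order all_algebra.
From mathcomp Require Import all_classical all_reals all_analysis.

Set Implicit Arguments.
Unset Strict Implicit.
Unset Printing Implicit Defensive.

Import Order.TTheory GRing.Theory Num.Theory.

Local Open Scope classical_set_scope.
Local Open Scope ring_scope.

Definition homeomorphism (X Y : topologicalType) (f : X -> Y) : Prop :=
  continuous f /\
  exists g : Y -> X, [/\ continuous g, cancel f g & cancel g f].

(* An IFS with k + 1 >= 1 generators is a family f : 'I_k.+1 -> X -> X; the
   generators need not be pairwise distinct. *)

Definition symmetric_ifs (X : Type) (k : nat) (f : 'I_k.+1 -> X -> X) : Prop :=
  forall i, exists j, cancel (f i) (f j) /\ cancel (f j) (f i).

Inductive semigroup_of (X : Type) (k : nat) (f : 'I_k.+1 -> X -> X) :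
    (X -> X) -> Prop :=
  | semigroup_gen (i : 'I_k.+1) : semigroup_of f (f i)
  | semigroup_comp (g h : X -> X) :
      semigroup_of f g -> semigroup_of f h -> semigroup_of f (g \o h).

Definition semigroup_orbit (X : Type) (k : nat) (f : 'I_k.+1 -> X -> X)
    (x : X) : set X :=
  [set g x | g in semigroup_of f].

Definition hutchinson (X : Type) (k : nat) (f : 'I_k.+1 -> X -> X)
    (K : set X) : set X :=
  \bigcup_(i in [set: 'I_k.+1]) f i @` K.

Definition quasi_attractor (X : topologicalType) (k : nat)
    (f : 'I_k.+1 -> X -> X) (A : set X) : Prop :=
  [/\ A !=set0, compact A, hutchinson f A = A &
      forall x, A x -> A = closure (semigroup_orbit f x)].

Definition pointwise_basin (X : topologicalType) (k : nat)
    (f : 'I_k.+1 -> X -> X) (A : set X) : set X :=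
  [set x | \bigcap_m closure
             (\bigcup_(n in [set n | (m <= n)%N]) iter n (hutchinson f) [set x])
           = A].

Definition symbol (k : nat) : Type := discrete_topology 'I_k.+1.
HB.instance Definition _ (k : nat) := DiscreteTopology.on (symbol k).
(* Measurable carriers must be pointed; which point is chosen is irrelevant. *)
HB.instance Definition _ (k : nat) := isPointed.Build (symbol k) ord0.

(* Sequences are indexed from 0: w n stands for omega_(n+1). *)
Definition Omega (k : nat) : Type := prod_topology (fun _ : nat => symbol k).
HB.instance Definition _ (k : nat) := Pointed.on (Omega k).
HB.instance Definition _ (k : nat) := Topological.on (Omega k).

Definition borel_Omega (k : nat) : measurableType _ :=
  g_sigma_algebraType (@open (Omega k)).

Definition random_iter (X : Type) (k : nat) (f : 'I_k.+1 -> X -> X)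
    (w : Omega k) : nat -> X -> X :=
  fix it (n : nat) : X -> X := if n is m.+1 then f (w m) \o it m else id.

(* The orbit starts at n = 1: x itself is not included. *)
Definition random_orbit (X : Type) (k : nat) (f : 'I_k.+1 -> X -> X)
    (w : Omega k) (x : X) : set X :=
  [set random_iter f w n.+1 x | n in [set: nat]].

Definition cylinder (k n : nat) (w : Omega k) : set (borel_Omega k) :=
  [set v : Omega k | forall j, (j < n)%N -> v j = w j].

Definition cond_prob d (T : measurableType d) (R : realType)
    (P : probability T R) (B C : set T) : R :=
  fine (P (B `&` C)) / fine (P C).

(* Conditioning on the first n symbols is stated on each past (a cylinder) of
   positive probability. *)
Definition symbols_bounded_below (k : nat) (R : realType)
    (P : probability (borel_Omega k) R) (p : R) : Prop :=
  forall (i : 'I_k.+1) (n : nat) (w : Omega k),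
    (0 < P (cylinder n w))%E ->
    p <= cond_prob P [set v : Omega k | v n = i] (cylinder n w).

Definition admissible (k : nat) (R : realType)
    (P : probability (borel_Omega k) R) : Prop :=
  exists p : R, [/\ 0 < p, p <= 1 / k.+1%:R & symbols_bounded_below P p].

Definition renderable (X : topologicalType) (k : nat)
    (f : 'I_k.+1 -> X -> X) (R : realType)
    (P : probability (borel_Omega k) R) (A : set X) : Prop :=
  exists Omega0 : set (borel_Omega k),
    [/\ measurable Omega0, P Omega0 = 1%E &
        forall w x, Omega0 w -> pointwise_basin f A x ->
          A `<=` closure (random_orbit f w x)].

(* Main.v *)
Require Import Defs.
From mathcomp Require Import all_boot all_order all_algebra.
From mathcomp Require Import all_classical all_reals all_analysis.

(* Since F is symmetric, x belongs to F^(2n)(x) for all n, so the pointwise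
   basin of A is contained in A. Given an open U meeting A, every z in A enters
   U along some nonempty word u; by compactness finitely many words suffice, and
   following each of them by its inverse word and concatenating gives a single
   word along which every point of A visits U. The orbit of a point of A stays in
   A, hence it visits U for every omega that contains this word. The sequences
   omega containing all finite words have probability one: a word of length L
   is missing from the first m disjoint blocks of length L with probability at
   most (1 - p^L)^m. *)

Set Implicit Arguments.
Unset Strict Implicit.
Unset Printing Implicit Defensive.

Import Order.TTheory GRing.Theory Num.Theory.

Local Open Scope classical_set_scope.
Local Open Scope ring_scope.

(** * Words, their action on points, and random orbits *)

Definition run (X : Type) (k : nat) (f : 'I_k.+1 -> X -> X) (u : seq 'I_k.+1)
    (x : X) : X :=
  foldl (fun y i => f i y) x u.

Definition factor_at (k : nat) (u : seq 'I_k.+1) (n : nat) :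
    set (borel_Omega k) :=
  [set v : Omega k | forall j, (j < size u)%N -> v (n + j)%N = nth ord0 u j].

Definition disjunctive (k : nat) : set (borel_Omega k) :=
  \bigcap_(u in [set: seq 'I_k.+1]) \bigcup_n factor_at u n.

Section Words.
Variables (X : Type) (k : nat) (f : 'I_k.+1 -> X -> X).

Lemma run_cat (u v : seq 'I_k.+1) (x : X) :
  run f (u ++ v) x = run f v (run f u x).
Proof. by rewrite /run foldl_cat. Qed.

(** Nonemptiness is recorded because [random_orbit] starts at time 1. *)
Lemma semigroup_run (g : X -> X) :
  semigroup_of f g -> exists2 u, u != [::] & g =1 run f u.
Proof.
elim=> [i|{}g h _ [u u0 gE] _ [v v0 hE]]; first by exists [:: i].
(* In [g \o h] the map [h] acts first, so its word is read first. *)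
exists (v ++ u); first by case: v v0 {hE}.
by move=> x; rewrite /= gE hE run_cat.
Qed.

Lemma run_invertible (hsym : symmetric_ifs f) (u : seq 'I_k.+1) :
  exists v, cancel (run f u) (run f v).
Proof.
elim: u => [|i u [v uK]]; first by exists [::].
have [j [fK _]] := hsym i.
by exists (rcons v j) => x; rewrite -cats1 run_cat /= uK fK.
Qed.

(* Each [u] is followed by its inverse word, which returns to the starting
   point; so one word traces the effect of all of them. *)
Lemma universal_word (hsym : symmetric_ifs f) (s : seq (seq 'I_k.+1)) :
  exists h, forall u, u \in s -> exists t1 t2,
    [/\ h = t1 ++ t2, (size u <= size t1)%N & run f t1 =1 run f u].
Proof.
elim: s => [|u s [h hs]]; first by exists [::].
have [v uK] := run_invertible hsym u.
exists (u ++ v ++ h) => w; rewrite inE => /orP[/eqP ->|/hs[t1 [t2 [-> le tE]]]].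
  by exists u, (v ++ h).
exists (u ++ v ++ t1), t2; split; first by rewrite -!catA.
  by rewrite !size_cat !addnA (leq_trans le) ?leq_addl.
by move=> x; rewrite !run_cat uK.
Qed.

Lemma random_iter_factor (u : seq 'I_k.+1) (n : nat) (w : Omega k) (x : X) :
  factor_at u n w ->
  random_iter f w (n + size u) x = run f u (random_iter f w n x).
Proof.
elim/last_ind: u => [|u i IH] wu; first by rewrite addn0.
rewrite size_rcons addnS /= -cats1 run_cat /= IH.
  by congr f; rewrite wu ?size_rcons// nth_rcons ltnn eqxx.
by move=> j ju; rewrite wu ?size_rcons ?(leqW ju)// nth_rcons ju.
Qed.

Lemma random_iter_invariant (A : set X) (w : Omega k) (n : nat) (x : X) :
  hutchinson f A `<=` A -> A x -> A (random_iter f w n x).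
Proof.
move=> FA Ax; elim: n => //= n IH; apply: FA.
by exists (w n) => //; exists (random_iter f w n x).
Qed.

Lemma hutchinson_even (hsym : symmetric_ifs f) (n : nat) (x : X) :
  iter n.*2 (hutchinson f) [set x] x.
Proof.
elim: n => //= n IH; have [j [fK _]] := hsym ord0.
by exists j => //; exists (f ord0 x) => //; exists ord0 => //; exists x.
Qed.

End Words.

(** * Visits of orbits to open sets *)

Section Visits.
Variables (X : topologicalType) (k : nat) (f : 'I_k.+1 -> X -> X).

Lemma pointwise_basin_sub (hsym : symmetric_ifs f) (A : set X) :
  pointwise_basin f A `<=` A.
Proof.
move=> x <- m _; apply: subset_closure.
exists m.*2; last exact: hutchinson_even.
by rewrite /= -addnn leq_addr.
Qed.

Lemma run_continuous (cf : forall i, continuous (f i)) (u : seq 'I_k.+1) :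
  continuous (run f u).
Proof.
elim: u => [|i u IH] x; first exact: cvg_id.
exact: (continuous_comp (@cf i x) (IH (f i x))).
Qed.

Lemma visiting_word (cf : forall i, continuous (f i)) (hsym : symmetric_ifs f)
    (A U : set X) : compact A -> open U ->
  (forall x, A x -> exists2 g, semigroup_of f g & U (g x)) ->
  exists h, forall x, A x -> exists t1 t2,
    [/\ h = t1 ++ t2, t1 != [::] & U (run f t1 x)].
Proof.
move=> cA oU AU.
pose traces h (u : seq 'I_k.+1) := exists t1 t2,
  [/\ h = t1 ++ t2, (size u <= size t1)%N & run f t1 =1 run f u].
(* [G] is the filter of the sets that contain, for some finite list [s], all words tracing every
   word of [s]. Compactness as a near-covering property then turns a word [u] for each point into
   one finite list for all of [A], and [universal_word] supplies an [h] for that list. *)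
pose G : set_system (seq 'I_k.+1) :=
  [set S | exists s : seq (seq 'I_k.+1),
     forall h, (forall u, u \in s -> traces h u) -> S h].
have GF : Filter G.
  split; first by exists [::].
    move=> S T [s sS] [t tT]; exists (s ++ t) => h st.
    by split; [apply: sS|apply: tT] => u us; apply: st;
      rewrite mem_cat us ?orbT.
  by move=> S T ST [s sS]; exists s => h /sS /ST.
have /compact_near_coveringP/(_ _ G (fun h x => exists t1 t2,
    [/\ h = t1 ++ t2, t1 != [::] & U (run f t1 x)]) GF) := cA.
case=> [x Ax|s sA].
  have [g /semigroup_run[u u0 gE] Ugx] := AU x Ax.
  exists (run f u @^-1` U, [set h | traces h u]); first split=> /=.
  - apply: open_nbhs_nbhs; split; last by rewrite /= -gE.
    by apply: open_comp => // y _; exact: run_continuous.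
  - by exists [:: u] => h; apply; rewrite inE.
  move=> [y h] /= [Uy [t1 [t2 [hE le tE]]]]; exists t1, t2; split=> //.
    by move: le; case: t1 {hE tE} => //; case: u u0 {gE Uy}.
  by rewrite tE.
by have [h hs] := universal_word hsym s; exists h; apply: sA.
Qed.

Lemma disjunctive_orbit_dense (cf : forall i, continuous (f i))
    (hsym : symmetric_ifs f) (A : set X) (hA : quasi_attractor f A)
    (w : Omega k) (x : X) :
  disjunctive w -> A x -> A `<=` closure (random_orbit f w x).
Proof.
case: hA => _ cA FA Amin dw Ax y Ay B.
rewrite nbhsE => -[U [oU Uy] UB].
have [|h hU] := visiting_word cf hsym cA oU.
  (* By minimality [y] lies in the closure of the semigroup orbit of [z], so this orbit meets
     [U]. *)
  move=> z Az; move: Ay; rewrite (Amin z Az).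
  by move=> /(_ U (open_nbhs_nbhs (conj oU Uy)))[_ [[g gG <-] Ugz]]; exists g.
have [n _ wh] := dw h I.
have FAA : hutchinson f A `<=` A by rewrite FA.
(* The point reached at time [n], where [h] begins in [w], is still in [A]; the prefix [t1] of [h]
   then leads it into [U]. *)
have [t1 [t2 [hE t10 Ut]]] := hU _ (random_iter_invariant w n FAA Ax).
have wt : factor_at t1 n w.
  move=> j jt; rewrite wh hE; last by rewrite size_cat ltn_addr.
  by rewrite nth_cat jt.
exists (random_iter f w (n + size t1) x); split; last first.
  by apply: UB; rewrite random_iter_factor.
(* The index [n] of [random_orbit] stands for time [n.+1]; the predecessor is legitimate since [t1]
   is nonempty. *)
exists (n + size t1).-1 => //.
by rewrite prednK// addn_gt0 [(0 < size t1)%N]lt0n size_eq0 t10 orbT.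
Qed.

End Visits.

(** * Events determined by finitely many symbols, and measurability *)

Definition determined (k n : nat) (E : set (borel_Omega k)) : Prop :=
  forall v w : Omega k, (forall j, (j < n)%N -> v j = w j) -> E v -> E w.

Section Cylinders.
Variable k : nat.
Local Notation Om := (borel_Omega k).

Lemma measurable_symbol (n : nat) (i : 'I_k.+1) :
  measurable ([set v : Omega k | v n = i] : set Om).
Proof.
apply: sub_sigma_algebra.
have -> : [set v : Omega k | v n = i] =
    (@proj nat (fun _ => symbol k) n) @^-1` [set i] by [].
apply: open_comp; last exact: discrete_open.
by move=> v _; exact: proj_continuous.
Qed.

Lemma measurable_factor_at (u : seq 'I_k.+1) (n : nat) :
  measurable (factor_at u n).
Proof.
have -> : factor_at u n = \bigcap_(j in [set j | (j < size u)%N])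
    [set v : Omega k | v (n + j)%N = nth ord0 u j] by [].
by apply: bigcap_measurableType => j _; exact: measurable_symbol.
Qed.

(** Indexing words by their codes makes the intersection one over the naturals, hence measurable.
    Codes of no word give [[::]], which is itself one of the words. *)
Lemma disjunctiveE : @disjunctive k =
  \bigcap_m \bigcup_n factor_at (odflt [::] (unpickle m)) n.
Proof.
apply/seteqP; split=> v dv; first by move=> m _; exact: dv.
by move=> u _; have := dv (pickle u) I; rewrite pickleK.
Qed.

Lemma measurable_disjunctive : measurable (@disjunctive k).
Proof.
rewrite disjunctiveE; apply: bigcapT_measurable => m.
by apply: bigcupT_measurable => n; exact: measurable_factor_at.
Qed.

Lemma measurable_cylinder (n : nat) (w : Omega k) :
  measurable (cylinder n w).
Proof.
have -> : cylinder n w = \bigcap_(j in [set j | (j < n)%N])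
    [set v : Omega k | v j = w j] by [].
by apply: bigcap_measurableType => j _; exact: measurable_symbol.
Qed.

(** This finite decomposition lets bounds conditional on a past of length [n] pass to [E] by
    summation. The padding of [t] by [ord0] beyond [n] affects neither [E] nor the cylinder. *)
Lemma determined_cylinders (n : nat) (E : set Om) : determined n E ->
  E = \bigcup_(t in [set t : n.-tuple 'I_k.+1 | E (nth ord0 t)])
        cylinder n (nth ord0 t).
Proof.
move=> dE; apply/seteqP; split=> [v Ev|v [t Et vt]].
  have vE j : (j < n)%N -> v j = nth ord0 [tuple v i | i < n] j.
    by move=> jn; rewrite -(tnth_nth _ _ (Ordinal jn)) tnth_mktuple.
  by exists [tuple v i | i < n] => //; apply: dE Ev.
by apply: dE Et => j /vt ->.
Qed.

Lemma trivIset_cylinder (n : nat) (D : set (n.-tuple 'I_k.+1)) :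
  trivIset D (fun t => cylinder n (nth ord0 t)).
Proof.
move=> s t _ _ [v [vs vt]]; apply: val_inj.
apply: (@eq_from_nth _ ord0) => [|j]; rewrite !size_tuple// => jn.
by rewrite -vs// vt.
Qed.

End Cylinders.

(** Only positions that are multiples of [size u] are tested: these blocks do not overlap, so block
    [m] lies just past the symbols that determine [avoiding u m]. *)
Definition avoiding (k : nat) (u : seq 'I_k.+1) (m : nat) :
    set (borel_Omega k) :=
  [set v | forall j, (j < m)%N -> ~ factor_at u (j * size u) v].

Lemma measurable_determined (k n : nat) (E : set (borel_Omega k)) :
  determined n E -> measurable E.
Proof.
move=> /determined_cylinders ->.
by apply: fin_bigcup_measurable => // t _; exact: measurable_cylinder.
Qed.

Lemma determined_factor_at (k n : nat) (E : set (borel_Omega k))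
    (u : seq 'I_k.+1) :
  determined n E -> determined (n + size u) (E `&` factor_at u n).
Proof.
move=> dE v w vw [Ev uv]; split; first by apply: dE Ev => j jn; apply/vw/ltn_addr.
by move=> j ju; rewrite -uv// vw// ltn_add2l.
Qed.

Lemma determined_avoiding (k : nat) (u : seq 'I_k.+1) (m : nat) :
  determined (m * size u) (avoiding u m).
Proof.
move=> v w vw Ev j jm wj; apply: (Ev j jm) => i iu; rewrite -wj// vw//.
by rewrite (leq_trans _ (leq_mul jm (leqnn (size u))))// mulSn addnC ltn_add2r.
Qed.

(** * Almost sure occurrence of every finite word *)

Section Probability.
Variables (k : nat) (R : realType) (P : probability (borel_Omega k) R) (p : R).
Hypothesis Pp : symbols_bounded_below P p.

Lemma cylinder_symbol_ge (n : nat) (w : Omega k) (i : 'I_k.+1) :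
  (p%:E * P (cylinder n w) <=
   P (cylinder n w `&` [set v : Omega k | v n = i]))%E.
Proof.
(* The hypothesis on [P] is silent on null pasts; there the left side vanishes. *)
have [P0|P0] := eqVneq (P (cylinder n w)) 0%E.
  by rewrite P0 mule0 measure_ge0.
have Pgt0 : (0 < P (cylinder n w))%E by rewrite lt0e P0 measure_ge0.
have := Pp i Pgt0; rewrite /cond_prob setIC.
have mc := measurable_cylinder n w.
have mi : measurable (cylinder n w `&` [set v : Omega k | v n = i]).
  by apply: measurableI => //; exact: measurable_symbol.
rewrite ler_pdivlMr -?lee_fin; last first.
  by rewrite fine_gt0// Pgt0 (le_lt_trans (probability_le1 _ mc))// ltry.
rewrite EFinM !fineK//; exact: fin_num_measure.
Qed.

Lemma determined_symbol_ge (n : nat) (E : set (borel_Omega k)) (i : 'I_k.+1) :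
  determined n E ->
  (p%:E * P E <= P (E `&` [set v : Omega k | v n = i]))%E.
Proof.
move=> dE; set C := [set v : Omega k | v n = i].
have mC : measurable (C : set (borel_Omega k)) by exact: measurable_symbol.
rewrite (determined_cylinders dE); set D := [set t : n.-tuple _ | _].
have mD t : D t -> measurable (cylinder n (nth ord0 t)).
  by move=> _; exact: measurable_cylinder.
have tD := @trivIset_cylinder k n D.
have mDC t : D t -> measurable (cylinder n (nth ord0 t) `&` C).
  by move=> Dt; apply: measurableI => //; exact: mD.
have fD : finite_set D by exact: finite_finset.
rewrite setI_bigcupl (measure_fin_bigcup P fD tD mD).
rewrite (measure_fin_bigcup P fD (trivIset_setIr tD) mDC).
rewrite ge0_mule_fsumr//.
by apply: lee_fsum => // t _; exact: cylinder_symbol_ge.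
Qed.

(** Letters are added at the end: [E] with an occurrence of the prefix at [n] is again determined by
    a finite past, so each new letter keeps at least a proportion [p] of the mass. *)
Lemma determined_factor_ge (p0 : 0 <= p) (n : nat) (E : set (borel_Omega k))
    (u : seq 'I_k.+1) :
  determined n E ->
  ((p ^+ size u)%:E * P E <= P (E `&` factor_at u n))%E.
Proof.
move=> dE; elim/last_ind: u => [|u i IH].
  rewrite expr0 mul1e; suff -> : E `&` factor_at [::] n = E by [].
  by apply/seteqP; split=> [v []|v Ev] //; split.
have -> : E `&` factor_at (rcons u i) n =
    (E `&` factor_at u n) `&` [set v : Omega k | v (n + size u)%N = i].
  apply/seteqP; split=> [v [Ev uv]|v [[Ev uv] vi]].
    split; first split=> // j ju.
      by rewrite uv ?size_rcons ?(leqW ju)// nth_rcons ju.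
    by rewrite /= uv ?size_rcons// nth_rcons ltnn eqxx.
  split=> // j; rewrite size_rcons nth_rcons ltnS leq_eqVlt.
  by case: ltnP => [ju _|_ /[1!orbF] je]; [exact: uv|rewrite je (eqP je)].
apply: le_trans (determined_symbol_ge i (determined_factor_at (u := u) dE)).
rewrite size_rcons exprS EFinM -muleA.
by apply: lee_wpmul2l => //; rewrite lee_fin.
Qed.

Lemma avoid_prob_le (p0 : 0 <= p) (p1 : p <= 1) (u : seq 'I_k.+1) (m : nat) :
  (P (avoiding u m) <= ((1 - p ^+ size u) ^+ m)%:E)%E.
Proof.
have mE l : measurable (avoiding u l).
  exact: measurable_determined (@determined_avoiding _ u l).
have finE l : P (avoiding u l) \is a fin_num by exact: fin_num_measure.
elim: m => [|m IH].
  by rewrite expr0; exact: probability_le1.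
have -> : avoiding u m.+1 = avoiding u m `\` factor_at u (m * size u).
  apply/seteqP; split=> [v Ev|v [Ev Sv] j].
    by split=> [j jm|]; apply: Ev => //; exact: leqW.
  by rewrite ltnS leq_eqVlt => /orP[/eqP ->//|]; exact: Ev.
have mS : measurable (factor_at u (m * size u)) by exact: measurable_factor_at.
rewrite measureD//; last by rewrite ltey_eq finE.
have pS := determined_factor_ge p0 u (@determined_avoiding _ u m).
(* Whatever the past, the next block equals [u] with conditional probability at least [p ^+ size u],
   so one more block multiplies the bound by [1 - p ^+ size u]. *)
apply: (@le_trans _ _ ((1 - p ^+ size u)%:E * P (avoiding u m))%E).
  rewrite EFinB muleBl ?fin_num_adde_defl// mul1e.
  exact: leeB.
rewrite exprS EFinM; apply: lee_wpmul2l => //.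
by rewrite lee_fin subr_ge0 exprn_ile1.
Qed.

Lemma factor_almost_surely (p0 : 0 < p) (p1 : p <= 1) (u : seq 'I_k.+1) :
  P (~` \bigcup_n factor_at u n) = 0%E.
Proof.
have mF : measurable (\bigcup_n factor_at u n).
  by apply: bigcupT_measurable => n; exact: measurable_factor_at.
have mN : measurable (~` \bigcup_n factor_at u n) by exact: measurableC.
have finN : P (~` \bigcup_n factor_at u n) \is a fin_num.
  exact: fin_num_measure.
apply/eqP; rewrite eq_le measure_ge0 andbT -(fineK finN) lee_fin.
pose q := 1 - p ^+ size u.
have q1 : `|q| < 1.
  rewrite ger0_norm ?subr_ge0 ?exprn_ile1 ?(ltW p0)//.
  by rewrite ltrBlDr ltrDl exprn_gt0.
(* Each [q ^+ m] bounds the probability from above, hence so does their limit 0. *)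
apply: (cvgr_to_ge (cvg_expr q1)); near=> m.
rewrite -lee_fin fineK//.
apply: le_trans (avoid_prob_le (ltW p0) p1 u m).
apply: le_measure; rewrite ?inE//.
  exact: measurable_determined (@determined_avoiding _ u m).
by move=> v nv j _ vj; apply: nv; exists (j * size u)%N.
Unshelve. all: end_near. Qed.

Lemma disjunctive_almost_surely (p0 : 0 < p) (p1 : p <= 1) :
  P (@disjunctive k) = 1%E.
Proof.
have mD := @measurable_disjunctive k.
suff : P.-negligible (~` @disjunctive k).
  rewrite negligibleP; last exact: measurableC.
  move=> /(congr1 (fun e => 1 - e)%E); rewrite sube0 => <-.
  by rewrite -[X in P X]setCK probability_setC//; exact: measurableC.
rewrite disjunctiveE setC_bigcap; apply: negligible_bigcup => m.
apply/negligibleP; last exact: factor_almost_surely.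
apply: measurableC; apply: bigcupT_measurable => n.
exact: measurable_factor_at.
Qed.

End Probability.

Theorem theorem4 (X : topologicalType) (hX : hausdorff_space X)
    (k : nat) (f : 'I_k.+1 -> X -> X)
    (hf : forall i, homeomorphism (f i)) (hsym : symmetric_ifs f)
    (R : realType) (P : probability (borel_Omega k) R) (hP : admissible P)
    (A : set X) (hA : quasi_attractor f A) :
  renderable f P A.
Proof.
have [p [p0 pk Pp]] := hP.
have p1 : p <= 1.
  by rewrite (le_trans pk)// ler_pdivrMr ?ltr0n// mul1r ler1n.
(* This event depends neither on [f] nor on [A], so it serves all starting points at once. *)
exists (@disjunctive k); split.
- exact: measurable_disjunctive.
- exact: disjunctive_almost_surely Pp p0 p1.
- move=> w x dw /(pointwise_basin_sub hsym) Ax.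
  by apply: disjunctive_orbit_dense dw Ax => // i; case: (hf i).
Qed.
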